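(* Let $K$ be a finite group with center $\{1\}$, let $n$ be a positive integer, and let $G=K^n$. Let $t$ be a positive integer and $\alpha$ a real number such that $2|K|^t\le \alpha\sqrt{n}$. Let $\mathbf{h}_1,\ldots,\mathbf{h}_t$ be independent uniformly random elements of $G$, let $H=\langle \mathbf{h}_1,\ldots,\mathbf{h}_t\rangle$ be the subgroup they generate, and let $\rho=\rho_1\otimes\cdots\otimes\rho_n\in\widehat{G}$ (with each $\rho_k\in\widehat{K}$) be chosen according to the Plancherel measure on $\widehat{G}$, independently of $\mathbf{h}_1,\ldots,\mathbf{h}_t$. Then $$\Pr_{\rho,\{\mathbf{h}_i\}}[X_H=0]\ \le\ \frac{2\alpha}{\sqrt{n}}+\left(2^{-1/\alpha}|K|^{\alpha}\right)^{\sqrt{n}},$$ where $X_H=\langle \operatorname{Res}_H\chi_\rho,1\rangle_H/d_\rho$. Consequently, there exists a representation $\rho=\rho_1\otimes\cdots\otimes\rho_n\in\widehat{G}$ such that $$\Pr_{\{\mathbf{h}_i\}}\left[\ \left\|\frac{1}{t}\sum_{i=1}^t\rho(\mathbf{h}_i)\right\|_{\mathrm{op}}<1\ \right]\ \le\ \frac{2\alpha}{\sqrt{n}}+\left(2^{-1/\alpha}|K|^{\alpha}\right)^{\sqrt{n}}.$$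
   Context: For a finite group $G$, $\widehat{G}$ denotes the set of (isomorphism classes of) irreducible complex representations of $G$, taken to be unitary. For $\rho\in\widehat{G}$, $\chi_\rho(g)=\operatorname{tr}\rho(g)$ is its character and $d_\rho=\chi_\rho(1)$ its dimension. The Plancherel measure on $\widehat{G}$ assigns to $\rho$ the probability $d_\rho^2/|G|$. The irreducible representations of $K^n$ are exactly the tensor products $\rho_1\otimes\cdots\otimes\rho_n$ with $\rho_k\in\widehat{K}$, the $k$-th coordinate acting on the $k$-th factor. For a subgroup $H$ of $G$ and $\rho\in\widehat{G}$, $\operatorname{Res}_H\chi_\rho$ is the restriction of $\chi_\rho$ to $H$, and $\langle\operatorname{Res}_H\chi_\rho,1\rangle_H=\frac{1}{|H|}\sum_{h\in H}\chi_\rho(h)$ is the multiplicity of the trivial representation of $H$ in the restriction of $\rho$ to $H$. Thus $X_H=\langle\operatorname{Res}_H\chi_\rho,1\rangle_H/d_\rho$ is a random variable depending on $\rho$ (and on $H$). $\|\cdot\|_{\mathrm{op}}$ is the operator norm. *)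

(* Defs.v *)
(* MathComp-Analysis reals; the complex numbers are R[i] over a realType R. *)
From HB Require Import structures.
From mathcomp Require Import all_boot all_order all_algebra all_fingroup.
From mathcomp Require Import center mxrepresentation complex.
From mathcomp Require Import all_classical all_reals all_analysis.

Set Implicit Arguments.
Unset Strict Implicit.
Unset Printing Implicit Defensive.

Import Order.TTheory GRing.Theory Num.Theory.
Local Open Scope ring_scope.

Section DirectPower.
Variables (gT : finGroupType) (n : nat).

Definition gpow_type : finGroupType := {dffun forall k : 'I_n, (fun=> gT) k}.

Definition gpow (K : {group gT}) : {group gpow_type} :=
  setXn_group (fun _ : 'I_n => K).

End DirectPower.

Section FiniteProbability.
Variable R : realType.

Definition Pr (T : finType) (mu : T -> R) (E : pred T) : R :=
  \sum_(x | E x) mu x.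

Definition prod_law (S T : finType) (mu : S -> R) (nu : T -> R) (x : S * T) : R :=
  mu x.1 * nu x.2.

Definition uniform_law (T : finType) (A : {set T}) (x : T) : R :=
  (x \in A)%:R / #|A|%:R.

Definition iid_law (T : finType) (mu : T -> R) (t : nat)
    (h : {ffun 'I_t -> T}) : R :=
  \prod_(i < t) mu (h i).

End FiniteProbability.

Section Representations.
Variable R : realType.

(* The isomorphism classes of irreducible complex representations of G, indexed
   as in the library by the Wedderburn components of the regular module;
   [irr_repr r] is a representative of the class [r]. *)
Definition dual (gT : finGroupType) (G : {group gT}) : irrType R[i] G :=
  DecSocleType (regular_repr R[i] G).

Definition plancherel (gT : finGroupType) (G : {group gT}) (r : dual G) : R :=
  (irr_degree r)%:R ^+ 2 / #|G|%:R.

(* [H] is meant to be a subgroup of [G]; outside of [G] the matrices [rG h] are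
   unspecified. *)
Definition inv_ratio (gT : finGroupType) (G : {group gT}) (d : nat)
    (rG : mx_representation R[i] G d) (H : {group gT}) : R[i] :=
  (#|H|%:R^-1 * \sum_(h in H) \tr (rG h)) / d%:R.

(* Each [rho x] acts on column vectors by left multiplication. *)
Definition unitary_repr (gT : finGroupType) (G : {group gT}) (d : nat)
    (rG : mx_representation R[i] G d) : Prop :=
  {in G, forall x, rG x \is unitarymx}.

Definition l2norm (d : nat) (v : 'cV[R[i]]_d) : R :=
  Num.sqrt (\sum_(j < d) ComplexField.Normc.normc (v j 0) ^+ 2).

Definition opnorm (d : nat) (A : 'M[R[i]]_d) : R :=
  sup [set l2norm (A *m v) | v in [set v | l2norm v <= 1]]%classic.

End Representations.

Section TensorProduct.
Variables (F : fieldType) (n : nat) (d : 'I_n -> nat).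

(* The standard basis e_(a 1) (x) ... (x) e_(a n) of the tensor product of the
   spaces F^(d k) is indexed by the families a with a k < d k; in this basis the
   entries of a Kronecker product are the products of the entries. *)
Definition tens_index : finType := {dffun forall k : 'I_n, 'I_(d k)}.

Definition tensmxn (A : forall k, 'M[F]_(d k)) : 'M[F]_#|tens_index| :=
  \matrix_(a, b) \prod_(k < n)
    A k ((enum_val a : tens_index) k) ((enum_val b : tens_index) k).

Lemma prod_sum_tens (P : forall k, 'I_(d k) -> F) :
  \prod_(k < n) \sum_(j < d k) P k j =
  \sum_(a : tens_index) \prod_(k < n) P k (a k).
Proof.
transitivity (\prod_(k < n) \sum_(j : 'I_(d k)) [ffun j => P k j] j).
  by apply: eq_bigr => k _; apply: eq_bigr => j _; rewrite ffunE.
under eq_bigr => k _ do rewrite (big_tag (fun k j => [ffun j => P k j] j)).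
rewrite bigA_distr_big_dep -big_fprod.
rewrite (reindex (@fprod_of_dffun _ (fun k => 'I_(d k)))) /=; last first.
  exact/onW_bij/fprod_of_dffun_bij.
by apply: eq_bigr => a _; apply: eq_bigr => k _; rewrite ffunE fprodE.
Qed.

Lemma tensmxn1 : tensmxn (fun k => 1%:M) = 1%:M.
Proof.
apply/matrixP => a b; rewrite !mxE -(inj_eq enum_val_inj).
have [<-|neq_ab] := eqVneq; first by rewrite big1 // => k _; rewrite mxE eqxx.
have [k neq_k] : exists k, (enum_val a : tens_index) k != (enum_val b : tens_index) k.
  apply/existsP; rewrite -negb_forall; apply: contra neq_ab => /forallP eq_ab.
  by apply/eqP/ffunP => k; apply/eqP.
by rewrite (bigD1 k) //= mxE (negPf neq_k) mul0r.
Qed.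

Lemma tensmxnM (A B : forall k, 'M[F]_(d k)) :
  tensmxn (fun k => A k *m B k) = tensmxn A *m tensmxn B.
Proof.
apply/matrixP => a b; rewrite !mxE.
under eq_bigr => k _ do rewrite mxE.
rewrite prod_sum_tens (reindex (@enum_val tens_index predT)) /=; last first.
  exact/onW_bij/enum_val_bij.
by apply: eq_bigr => c _; rewrite !mxE big_split.
Qed.

Variables (gT : finGroupType) (K : {group gT}).
Variable rho : forall k, mx_representation F K (d k).

Definition tens_fun (g : gpow_type gT n) : 'M[F]_#|tens_index| :=
  tensmxn (fun k => rho k (g k)).

Lemma tens_fun_repr : mx_repr (gpow n K) tens_fun.
Proof.
split=> [|x y /setXnP Kx /setXnP Ky].
  by rewrite -tensmxn1; congr tensmxn; apply: functional_extensionality_dep => k;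
    rewrite ffunE repr_mx1.
rewrite -tensmxnM; congr tensmxn; apply: functional_extensionality_dep => k.
by rewrite ffunE repr_mxM.
Qed.

Definition tens_repr := MxRepresentation tens_fun_repr.

End TensorProduct.

(* Main.v *)
(* For g, h in G put tw(g, h) = #{a in G | g a h = a}.  Since the sum over the
   irreducible characters of chi(g) chi(h) is tw(g, h), Chebyshev's inequality
   bounds the Plancherel probability of X_H = 0, for a fixed subgroup H, by
     sum_{g in H, g <> 1} sum_{h in H} tw(g, h) / |G|.
   In G = K^n, tw is the product of its analogues in the coordinates, and as K
   is centerless a coordinate g_k <> 1 contributes at most |K| / 2: hence
   tw(g, h) / |G| <= 2^-(number of k with g_k <> 1).
   Every element of H = <h_1, ..., h_t> has the form k |-> f(h_1(k), ..., h_t(k))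
   for some f : K^t -> K, so that |H| <= |K|^M with M = |K|^t, and for a fixed
   nontrivial f the expectation of 2^-support over the independent coordinates
   is at most (1 - 1/(2M))^n.  Altogether the probability is at most
   |K|^(2M) (1 - 1/(2M))^n <= |K|^(alpha sqrt n) e^(- sqrt n / alpha).
   The same computation applies to the tensor products of irreducible unitary
   representations of K, drawn with the product of the Plancherel measures; some
   tensor product does at least as well as the average.  When X_H <> 0, it has
   a nonzero vector fixed by all the h_i, so that the mean of the h_i has norm
   at least 1. *)
Require Import Defs.
From HB Require Import structures.
From mathcomp Require Import all_boot all_order all_algebra all_fingroup.
From mathcomp Require Import center mxrepresentation complex.
From mathcomp Require Import lra.
From mathcomp Require Import all_classical all_reals all_analysis.

Set Implicit Arguments.
Unset Strict Implicit.
Unset Printing Implicit Defensive.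

Import Order.TTheory GRing.Theory Num.Theory.
Local Open Scope ring_scope.

(** * Traces of idempotents and sums over irreducible characters *)

(** A rank factorization [P = A *m B] of an idempotent satisfies [B *m A = 1], and the trace is
    cyclic. *)
Lemma mxtrace_idempotent (F : fieldType) (m : nat) (P : 'M[F]_m) :
  P *m P = P -> \tr P = (\rank P)%:R.
Proof.
move: (mulmx_base P) (row_base_free P) (col_base_full P).
move: (col_base P) (row_base P); move: (\rank P) => r A B <-.
move=> /row_freeP[B' BK] /row_fullP[A' AK] idP; rewrite mxtrace_mulC.
suff -> : B *m A = 1%:M by rewrite mxtrace1.
have := congr1 (fun M => A' *m (M *m B')) idP.
by rewrite -!mulmxA BK mulmx1 !mulmxA AK !mul1mx.
Qed.

(** The condition says [a * h * a^-1 = g^-1]; for a group [G] the set is thus empty or a coset of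
    the centralizer of [g] in [G]. *)
Definition twisted_fix (gT : finGroupType) (G : {set gT}) (g h : gT) : {set gT} :=
  [set a in G | (g * a * h)%g == a].

Section Characters.
Variables (C : numClosedFieldType) (gT : finGroupType) (G : {group gT}).

Lemma mxtrace_regular_repr (g : gT) : g \in G ->
  \tr (regular_repr C G g) = (#|G| * (g == 1%g))%:R.
Proof.
move=> Gg; rewrite /mxtrace.
rewrite (eq_bigr (fun=> (g == 1%g)%:R)); last first.
  move=> i _; rewrite !mxE /= eq_sym -(inj_eq enum_val_inj).
  rewrite gring_indexK ?groupM ?enum_valP //.
  by rewrite -{2}[enum_val i]mulg1 (inj_eq (mulgI _)).
by rewrite sumr_const card_ord natrM mulrC mulr_natr.
Qed.

(** The sum of the conjugates of [rG h] commutes with [rG], hence is scalar by Schur's lemma, and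
    its trace determines the scalar. The factor [d] replaces a division by the degree. *)
Lemma irr_center_mean (d : nat) (rG : mx_representation C G d) (g h : gT) :
    mx_absolutely_irreducible rG -> g \in G -> h \in G ->
  d%:R * \sum_(a in G) \tr (rG (g * a * h * a^-1)%g) =
    #|G|%:R * (\tr (rG g) * \tr (rG h)).
Proof.
move=> absG Gg Gh; pose M := \sum_(a in G) rG (a * h * a^-1)%g.
have cGM : centgmx rG M.
  apply/centgmxP => x Gx; rewrite /M mulmx_suml mulmx_sumr.
  rewrite [RHS](reindex_inj (mulgI x^-1)%g).
  apply: eq_big => a; first by rewrite groupMl ?groupV.
  move=> Ga; rewrite -!repr_mxM ?(groupM, groupV) //.
  by rewrite invMg invgK !mulgA mulgV mul1g.
have trM : \tr M = #|G|%:R * \tr (rG h).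
  rewrite /M raddf_sum /= (eq_bigr (fun=> \tr (rG h))); last first.
    move=> a Ga; rewrite -mulgA repr_mxM ?groupM ?groupV // mxtrace_mulC.
    by rewrite -repr_mxM ?groupM ?groupV // mulgKV.
  by rewrite sumr_const mulr_natl.
have /is_scalar_mxP[m defM] := mx_abs_irr_cent_scalar absG cGM.
have -> : \sum_(a in G) \tr (rG (g * a * h * a^-1)%g) = \tr (rG g *m M).
  rewrite /M mulmx_sumr raddf_sum; apply: eq_bigr => a Ga /=.
  by rewrite -!repr_mxM ?groupM ?groupV // !mulgA.
rewrite [RHS]mulrCA -trM defM mul_mx_scalar mxtraceZ mxtrace_scalar.
by rewrite [RHS]mulrC -[m *+ d]mulr_natl mulrA.
Qed.

(* By [irr_center_mean], a product chi(g) chi(h) is an average of the values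
   chi(1) chi(g a h a^-1); summing over chi gives the regular character. *)
Lemma irr_second_orthogonality (sG : irrType C G) (g h : gT) :
    g \in G -> h \in G ->
  \sum_(i : sG) \tr (irr_repr i g) * \tr (irr_repr i h) =
    #|twisted_fix G g h|%:R.
Proof.
move=> Gg Gh; have G0 : #|G|%:R != 0 :> C by rewrite pnatr_eq0 -lt0n cardG_gt0.
apply: (mulfI G0); rewrite mulr_sumr.
under eq_bigr => i _.
  rewrite -irr_center_mean //; last first.
    exact/group_closure_closed_field/socle_irr.
  rewrite mulr_sumr; over.
rewrite exchange_big /=.
rewrite (eq_bigr (fun a => (#|G| * ((g * a * h)%g == a))%:R)); last first.
  move=> a Ga; have <- : (g * a * h * a^-1 == 1)%g = (g * a * h == a)%g.
    by rewrite -eq_mulgV1.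
  rewrite -mxtrace_regular_repr ?groupM ?groupV //.
  rewrite (mxtrace_regular_pchar sG) ?groupM ?groupV //.
  - by apply: eq_bigr => i _; rewrite mulr_natl.
  - by apply/andP; split=> //; apply/allP => p _; rewrite inE /= (pchar_num C p).
  - exact: group_closure_closed_field.
rewrite -natr_sum -big_distrr /= natrM; congr (_ * _%:R).
rewrite -sum1_card big_mkcond [RHS]big_mkcond; apply: eq_bigr => a _.
by rewrite !inE; case: (a \in G) => //=; case: eqP.
Qed.

End Characters.

(** * Unitary representatives *)

Local Open Scope sesquilinear_scope.

(** Weyl's averaging trick: the form [P] is positive definite and invariant under [rG]. Writing
    [P = L *m L^t*], conjugation by [L] makes [rG] unitary. *)
Lemma unitary_rsim (C : numClosedFieldType) (gT : finGroupType) (G : {group gT})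
    (d : nat) (rG : mx_representation C G d) :
  exists2 sG : mx_representation C G d,
    mx_rsim rG sG & {in G, forall x, sG x \is unitarymx}.
Proof.
pose P := \sum_(x in G) rG x *m (rG x)^t*.
have invP y : y \in G -> rG y *m P *m (rG y)^t* = P.
  move=> Gy; rewrite /P mulmx_sumr mulmx_suml.
  rewrite [RHS](reindex_inj (mulgI y)) /=; apply: eq_big => x.
    by rewrite groupMl.
  by move=> Gx; rewrite repr_mxM // trmx_mul map_mxM /= !mulmxA.
have hermP : P \is hermsymmx.
  apply/is_hermitianmxP; rewrite expr0 scale1r.
  rewrite /P raddf_sum raddf_sum; apply: eq_bigr => x _ /=.
  by rewrite trmx_mul map_mxM /= trmxCK.
have defP := orthomx_spectralP (hermitian_normalmx hermP).
set U := spectralmx P in defP; set D := spectral_diag P in defP.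
have unitU : U \is unitarymx := spectral_unitarymx P.
have unitmxU : U \in unitmx := spectral_unit P.
(* The summand [x = 1] contributes 1 to the diagonal entry below, and every other summand
   contributes a sum of squared moduli. *)
have D_gt0 j : 0 < D 0 j.
  have -> : D 0 j = (U *m P *m U^t*) j j.
    by rewrite defP -invmx_unitary // !mulmxA mulmxV // mul1mx mulmxK // !mxE eqxx mulr1n.
  rewrite /P mulmx_sumr mulmx_suml summxE (bigD1 1%g) ?group1 //=.
  rewrite repr_mx1 trmx1 map_mx1 !mulmx1 (unitarymxP unitU) mxE eqxx.
  rewrite ltr_wpDr ?ltr01 // sumr_ge0 // => x _.
  rewrite mulmxA -mulmxA -map_mxM -trmx_mul mxE sumr_ge0 // => k _.
  by rewrite !mxE -normCK exprn_ge0.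
pose S := diag_mx (\row_j sqrtC (D 0 j)).
have unitS : S \in unitmx.
  rewrite unitmxE det_diag unitfE; apply/prodf_neq0 => j _.
  by rewrite mxE sqrtC_eq0 gt_eqF.
have hermS : S^t* = S.
  rewrite /S tr_diag_mx map_diag_mx; congr diag_mx; apply/rowP => j.
  by rewrite !mxE; apply/CrealP; rewrite ger0_real // sqrtC_ge0 ltW.
have sqrS : S *m S = diag_mx D.
  rewrite /S mulmx_diag; congr diag_mx; apply/rowP => j.
  by rewrite !mxE -expr2 sqrtCK.
have [L unitL defPL] : exists2 L : 'M[C]_d, L \in unitmx & P = L *m L^t*.
  exists (invmx U *m S); first by rewrite unitmx_mul unitmx_inv unitmxU.
  rewrite trmx_mul map_mxM /= hermS mulmxA -(mulmxA _ S S) sqrS.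
  by rewrite {1}defP invmx_unitary // trmxCK.
pose sf x := invmx L *m rG x *m L.
have sf_repr : mx_repr G sf.
  split=> [|x y Gx Gy]; first by rewrite /sf repr_mx1 mulmx1 mulVmx.
  by rewrite /sf repr_mxM // !mulmxA mulmxK.
exists (MxRepresentation sf_repr).
  exists L; rewrite ?row_free_unit // => x Gx /=.
  by rewrite /sf !mulmxA mulmxV // mul1mx.
move=> x Gx; apply/unitarymxP; rewrite /= /sf.
rewrite !trmx_mul !map_mxM /= !mulmxA.
rewrite -(mulmxA (_ *m rG x)) -defPL -(mulmxA (invmx L)) -(mulmxA (invmx L)).
rewrite invP // defPL mulmxA mulVmx // mul1mx.
by rewrite -map_mxM -trmx_mul mulVmx // trmx1 map_mx1.
Qed.

Local Close Scope sesquilinear_scope.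

(** * Tensor products of representations *)

Section TensorPower.
Variables (F : fieldType) (n : nat) (d : 'I_n -> nat).
Variables (gT : finGroupType) (K : {group gT}).
Variable rho : forall k, mx_representation F K (d k).

Lemma card_tens_index : #|tens_index d| = (\prod_(k < n) d k)%N.
Proof.
rewrite -cardsT.
have -> : [set: tens_index d] = setXn (fun k => [set: 'I_(d k)]).
  by apply/setP => a; rewrite !inE; apply/esym/forallP => k; rewrite inE.
by rewrite cardsXn; apply: eq_bigr => k _; rewrite cardsT card_ord.
Qed.

Lemma mxtrace_tens (A : forall k, 'M[F]_(d k)) :
  \tr (tensmxn A) = \prod_(k < n) \tr (A k).
Proof.
rewrite /mxtrace prod_sum_tens (reindex (@enum_val (tens_index d) predT)) /=.
  by apply: eq_bigr => a _; rewrite mxE.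
exact/onW_bij/enum_val_bij.
Qed.

Lemma prod_sum_gpow (f : 'I_n -> gT -> F) :
  \prod_(k < n) \sum_(x in K) f k x = \sum_(g in gpow n K) \prod_k f k (g k).
Proof. by rewrite bigA_distr_big; apply: eq_bigl => g; rewrite !inE. Qed.

Lemma tensmxn_sum (c : 'I_n -> gT -> F) :
  tensmxn (fun k => \sum_(x in K) c k x *: rho k x) =
  \sum_(g in gpow n K) (\prod_k c k (g k)) *: tens_repr rho g.
Proof.
apply/matrixP => p q; rewrite mxE summxE.
under eq_bigr => k _ do rewrite summxE.
rewrite prod_sum_gpow; apply: eq_bigr => g _; rewrite !mxE -big_split.
by apply: eq_bigr => k _; rewrite mxE.
Qed.

(** Absolute irreducibility amounts to a positive degree and to the matrices of the representation
    spanning the full matrix algebra. Matrix units of the tensor product are Kronecker products of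
    matrix units, which expand by multilinearity. *)
Lemma tens_abs_irr :
    (forall k, mx_absolutely_irreducible (rho k)) ->
  mx_absolutely_irreducible (tens_repr rho).
Proof.
move=> absr; apply/mx_abs_irrP; split.
  rewrite card_tens_index prodn_gt0 // => k.
  by have /mx_abs_irrP[] := absr k.
have /(_ _)/cid a_ k : exists a, forall A, A = \sum_(x in K) a x A *: rho k x.
  by have /mx_abs_irrP[] := absr k.
pose E (p q : 'I_#|tens_index d|) k : 'M[F]_(d k) :=
  delta_mx ((enum_val p : tens_index d) k) ((enum_val q : tens_index d) k).
have deltaE p q : delta_mx p q = tensmxn (E p q).
  apply/matrixP => i j; rewrite !mxE -!(inj_eq enum_val_inj).
  under eq_bigr => k _ do rewrite mxE.
  have [/andP[/eqP-> /eqP->]|ne_pq] := boolP (_ && _).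
    by rewrite big1 // => k _; rewrite !eqxx.
  have [k /negPf ne_k] : exists k, ~~ ((enum_val i k == enum_val p k) &&
      ((enum_val j : tens_index d) k == (enum_val q : tens_index d) k)).
    apply/existsP; rewrite -negb_forall; apply: contra ne_pq => /forallP eq_pq.
    by apply/andP; split; apply/eqP/ffunP => k; case/andP: (eq_pq k) => /eqP ? /eqP ?.
  by rewrite (bigD1 k) //= ne_k mul0r.
exists (fun (g : gpow_type gT n) (A : 'M[F]_#|tens_index d|) => \sum_p \sum_q
  A p q * \prod_k projT1 (a_ k) (g k) (E p q k)) => A.
rewrite {1}(matrix_sum_delta A).
under [RHS]eq_bigr => g _ do rewrite scaler_suml.
rewrite [RHS]exchange_big; apply: eq_bigr => p _.
under [RHS]eq_bigr => g _ do rewrite scaler_suml.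
rewrite [RHS]exchange_big; apply: eq_bigr => q _.
under [RHS]eq_bigr => g _ do rewrite -scalerA.
rewrite -scaler_sumr -(tensmxn_sum (fun k x => projT1 (a_ k) x (E p q k))).
rewrite deltaE; congr (_ *: tensmxn _).
by apply: functional_extensionality_dep => k; case: (a_ k).
Qed.

End TensorPower.

Lemma twisted_fix_gpow (gT : finGroupType) (n : nat) (K : {group gT})
    (g h : gpow_type gT n) :
  #|twisted_fix (gpow n K) g h| = (\prod_(k < n) #|twisted_fix K (g k) (h k)|)%N.
Proof.
have -> : twisted_fix (gpow n K) g h = setXn (fun k => twisted_fix K (g k) (h k)).
  apply/setP => a; rewrite in_setXn inE.
  apply/andP/forallP => [[/setXnP Ka /eqP fix_a] k|fix_a].
    by rewrite inE Ka -{2}fix_a !ffunE /=.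
  split; first by apply/setXnP => k; have /[!inE]/andP[] := fix_a k.
  by apply/eqP/ffunP => k; have /[!inE]/andP[_ /eqP<-] := fix_a k; rewrite !ffunE.
by rewrite cardsXn.
Qed.

(** Characters of tensor products and twisted fixed points both factor over the coordinates. *)
Lemma second_orthogonality_tens (F : fieldType) (gT : finGroupType) (n : nat)
    (K : {group gT}) (I : finType) (d : I -> nat)
    (rho : forall i, mx_representation F K (d i)) :
    {in K &, forall g h,
      \sum_i \tr (rho i g) * \tr (rho i h) = #|twisted_fix K g h|%:R} ->
  {in gpow n K &, forall g h,
    \sum_(r : {ffun 'I_n -> I})
      \tr (tens_repr (fun k => rho (r k)) g) * \tr (tens_repr (fun k => rho (r k)) h)
    = #|twisted_fix (gpow n K) g h|%:R}.
Proof.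
move=> orth g h /setXnP Kg /setXnP Kh.
rewrite twisted_fix_gpow natr_prod.
under [RHS]eq_bigr => k _ do rewrite -orth //.
rewrite bigA_distr_bigA /=; apply: eq_bigr => r _.
by rewrite /tens_fun !mxtrace_tens -big_split.
Qed.

(** * Second moment of the multiplicity of the trivial representation *)

Section SecondMoment.
Variables (R : realType) (gT : finGroupType) (G H : {group gT}).
Hypothesis sHG : H \subset G.

Section Projection.
Variables (d : nat) (rG : mx_representation R[i] G d).

Let P := #|H|%:R^-1 *: \sum_(h in H) rG h.

Let H_neq0 : #|H|%:R != 0 :> R[i].
Proof. by rewrite pnatr_eq0 -lt0n cardG_gt0. Qed.

Let HG (h : gT) : h \in H -> h \in G. Proof. exact: (fintype.subsetP sHG). Qed.

Lemma group_mean_fixed (h : gT) : h \in H -> rG h *m P = P.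
Proof.
move=> Hh; rewrite /P -scalemxAr mulmx_sumr; congr (_ *: _).
rewrite [RHS](reindex_inj (mulgI h)) /=; apply: eq_big => x.
  by rewrite groupMl.
by move=> Hx; rewrite repr_mxM ?HG.
Qed.

Lemma group_mean_idempotent : P *m P = P.
Proof.
rewrite {1}/P -scalemxAl mulmx_suml.
rewrite (eq_bigr (fun=> P)) => [|h Hh]; last exact: group_mean_fixed.
by rewrite sumr_const -[P *+ _]scaler_nat scalerA mulVf ?scale1r.
Qed.

(** The mean over [H] projects onto the fixed vectors, so the character sum is [#|H|] times a
    dimension; in particular it is real, so that its squares can be compared in [R[i]]. *)
Lemma sum_trace_rank :
  \sum_(h in H) \tr (rG h) = #|H|%:R * (\rank P)%:R.
Proof.
rewrite -(mxtrace_idempotent group_mean_idempotent) /P mxtraceZ raddf_sum.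
by rewrite mulrA mulfV ?mul1r.
Qed.

Lemma inv_ratioE : inv_ratio rG H = (\rank P)%:R / d%:R.
Proof. by rewrite /inv_ratio sum_trace_rank mulKf. Qed.

End Projection.

Variables (I : finType) (d : I -> nat).
Variable rho : forall i, mx_representation R[i] G (d i).

(** Assumed of an arbitrary family, so that the bound covers both the classes in [dual] and the
    tensor products over K^n. *)
Hypothesis orth : {in G &, forall g h,
  \sum_i \tr (rho i g) * \tr (rho i h) = #|twisted_fix G g h|%:R}.

Lemma sum_sqr_degree : (\sum_i d i ^ 2 = #|G|)%N.
Proof.
apply/eqP; rewrite -(eqr_nat R[i]) natr_sum; apply/eqP.
have -> : #|G| = #|twisted_fix G 1%g 1%g|.
  by apply: eq_card => a; rewrite !inE mul1g mulg1 eqxx andbT.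
rewrite -orth ?group1 //; apply: eq_bigr => i _.
by rewrite repr_mx1 mxtrace1 natrX.
Qed.

Lemma sum_twisted_fix1 : (\sum_(h in H) #|twisted_fix G 1%g h| = #|G|)%N.
Proof.
rewrite (bigD1 1%g) //= big1 ?addn0.
  by apply: eq_card => a; rewrite !inE mul1g mulg1 eqxx andbT.
move=> h /andP[_ h_neq1]; apply: eq_card0 => a.
by rewrite !inE mul1g -{3}[a]mulg1 (inj_eq (mulgI _)) (negPf h_neq1) andbF.
Qed.

(* Chebyshev: the right-hand side is |G| times the variance of |H| X_H, since
   the terms with g = 1 of its second moment add up to the square of its mean,
   which is 1. *)
Lemma sum_sqr_degree_inv_ratio_eq0 :
  (\sum_(i | inv_ratio (rho i) H == 0%R) d i ^ 2 <=
   \sum_(g in H :\ 1%g) \sum_(h in H) #|twisted_fix G g h|)%N.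
Proof.
rewrite -(ler_nat R[i]) natr_sum.
pose S i := \sum_(h in H) \tr (rho i h).
have HG h : h \in H -> h \in G by exact: (fintype.subsetP sHG).
have sum_S : \sum_i S i * (d i)%:R = #|G|%:R.
  rewrite -sum_twisted_fix1 natr_sum.
  under [RHS]eq_bigr => h Hh do rewrite -orth ?HG //.
  rewrite exchange_big; apply: eq_bigr => i _; rewrite mulr_suml.
  by apply: eq_bigr => h _; rewrite repr_mx1 mxtrace1 mulrC.
have sum_SS : \sum_i S i ^+ 2 =
    (\sum_(g in H :\ 1%g) \sum_(h in H) #|twisted_fix G g h|)%:R + #|G|%:R.
  rewrite -sum_twisted_fix1 -natrD addnC -big_setD1 //= natr_sum.
  under [RHS]eq_bigr => g Hg.
    rewrite natr_sum.
    under eq_bigr => h Hh do rewrite -orth ?HG //.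
    over.
  under [RHS]eq_bigr => g Hg do rewrite exchange_big.
  rewrite exchange_big /=; apply: eq_bigr => i _.
  by rewrite expr2 mulr_suml; apply: eq_bigr => g _; rewrite mulr_sumr.
apply: (@le_trans _ _ (\sum_i (S i - (d i)%:R) ^+ 2)).
  rewrite big_mkcond; apply: ler_sum => i _.
  rewrite inv_ratioE mulf_eq0 invr_eq0 natrX.
  have real_S : S i - (d i)%:R \is Num.real.
    by rewrite /S sum_trace_rank -natrM rpredB ?realn.
  case: ifPn => [|_]; last by rewrite -real_normK // exprn_ge0.
  (* The ratio vanishes if the rank is 0, where the square is [d i ^ 2], or if [d i = 0], by the
     convention for division by 0. *)
  move=> /orP[]/eqP d0; last by rewrite d0 expr0n real_exprn_even_ge0 // -d0.
  by rewrite /S sum_trace_rank d0 mulr0 sub0r sqrrN.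
under [X in X <= _]eq_bigr => i _ do rewrite sqrrB mulr2n opprD !addrA.
rewrite !big_split /= !sumrN sum_S sum_SS.
under [X in _ + X <= _]eq_bigr => i _ do rewrite -natrX.
by rewrite -natr_sum sum_sqr_degree addrK subrK.
Qed.

End SecondMoment.

(** * Twisted fixed points in a centerless group *)

(** A nonempty [twisted_fix K g h] is no larger than the centralizer of [g], which for [g] not
    central is a proper subgroup, of index at least 2. *)
Lemma twisted_fix_half (gT : finGroupType) (K : {group gT}) (g h : gT) :
  'Z(K)%g = 1%g -> g \in K -> (2 ^ (g != 1%g) * #|twisted_fix K g h| <= #|K|)%N.
Proof.
move=> Z1 Kg; have [_|g_neq1] := eqVneq g 1%g.
  by rewrite mul1n; apply/subset_leq_card/fintype.subsetP => a /[!inE] /andP[].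
have [->|[a0]] := set_0Vmem (twisted_fix K g h); first by rewrite cards0 muln0.
rewrite inE => /andP[Ka0 /eqP fix_a0].
have : (#|twisted_fix K g h| <= #|'C_K[g]%g|)%N.
  rewrite -(card_imset _ (mulIg a0^-1%g)); apply/subset_leq_card/fintype.subsetP.
  move=> _ /imsetP[a tw_a ->]; move: tw_a; rewrite inE => /andP[Ka /eqP fix_a].
  apply/setIP; split; first by rewrite groupM ?groupV.
  apply/cent1P; rewrite /commute.
  (* Dividing the relations [g * a * h = a] and [g * a0 * h = a0] eliminates [h]. *)
  have E : (a * a0^-1 = g * (a * a0^-1) * g^-1)%g.
    by rewrite -{1}fix_a -{1}fix_a0 !invMg !mulgA mulgK.
  by rewrite {1}E mulgKV.
move=> le_tw; apply: leq_trans (leq_mul (leqnn 2) le_tw) _.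
rewrite -(Lagrange (subcent1_sub g K)) mulnC leq_mul2l indexg_gt1 orbC.
apply/orP; left; apply: contraNN g_neq1 => /subsetIP[_ cKg].
have : g \in 'Z(K)%g by apply/setIP; rewrite -sub_cent1.
by rewrite Z1 inE.
Qed.

(** * Subgroups generated by random elements of K^n *)

Section RandomSubgroup.
Variables (R : realType) (gT : finGroupType) (K : {group gT}) (n t : nat).

Definition generator_row (h : {ffun 'I_t -> gpow_type gT n}) (k : 'I_n) :
  {ffun 'I_t -> gT} := [ffun i => h i k].

Definition eval_rows (h : {ffun 'I_t -> gpow_type gT n})
    (f : {ffun {ffun 'I_t -> gT} -> gT}) : gpow_type gT n :=
  [ffun k => f (generator_row h k)].

(* Words in t letters act on K^t through such maps; arbitrary maps are allowed,
   with the value 1 outside of K^t, as only their number matters. *)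
Definition word_maps := pffun_on 1%g (ffun_on K : {pred {ffun 'I_t -> gT}}) K.

Lemma card_word_maps : #|word_maps| = (#|K| ^ (#|K| ^ t))%N.
Proof. by rewrite card_pffun_on card_ffun_on card_ord. Qed.

Lemma word_mapsP (f : {ffun {ffun 'I_t -> gT} -> gT}) :
  reflect (forall x, if x \in ffun_on K then f x \in K else f x == 1%g)
          (f \in word_maps).
Proof.
apply: (iffP pffun_onP) => [[/fintype.subsetP suppf Kf] x|Kf].
  case: ifPn => [Kx|nKx]; first exact/Kf/fintype.image_f.
  by have := contra (suppf x) nKx; rewrite inE negbK.
split=> [|_ /fintype.imageP[x Kx ->]]; last by have := Kf x; rewrite Kx.
apply/fintype.subsetP => x; rewrite inE; apply: contraR => /negPf nKx.
by have := Kf x; rewrite nKx.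
Qed.

(** The values at [h] of the maps in [word_maps] form a group under pointwise product, and the
    projection to the i-th letter, set to 1 outside of K^t, yields [h i]. *)
Lemma gen_sub_eval_rows (h : {ffun 'I_t -> gpow_type gT n}) :
    (forall i, h i \in gpow n K) ->
  <<[set h i | i : 'I_t]>>%g \subset [set eval_rows h f | f in word_maps].
Proof.
move=> Gh.
have groupA : group_set [set eval_rows h f | f in word_maps].
  apply/group_setP; split.
    apply/imsetP; exists [ffun=> 1%g]; last by apply/ffunP => k; rewrite !ffunE.
    by apply/word_mapsP => x; rewrite ffunE group1 eqxx if_same.
  move=> _ _ /imsetP[f /word_mapsP Wf ->] /imsetP[f' /word_mapsP Wf' ->].
  apply/imsetP; exists [ffun x => f x * f' x]%g; last first.
    by apply/ffunP => k; rewrite !ffunE.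
  apply/word_mapsP => x; rewrite ffunE; have := Wf' x; have := Wf x.
  by case: ifP => _; [apply: groupM | move=> /eqP-> /eqP->; rewrite mulg1].
rewrite (gen_subG _ (Group groupA)); apply/fintype.subsetP => _ /imsetP[i _ ->].
apply/imsetP.
exists [ffun x : {ffun 'I_t -> gT} => if x \in ffun_on K then x i else 1%g].
  apply/word_mapsP => x; rewrite ffunE; case: ifPn => [/ffun_onP Kx|nKx].
    by case: ifP => _; rewrite ?Kx ?group1.
  by case: ifP => // /(negP nKx).
apply/ffunP => k; rewrite !ffunE ifT ?ffunE //; apply/ffun_onP => j.
by rewrite ffunE; have /setXnP := Gh j; apply.
Qed.

Definition half_support (g : gpow_type gT n) : R := \prod_k 2^-1 ^+ (g k != 1%g).

Definition unif_row (x : {ffun 'I_t -> gT}) : R := \prod_i uniform_law R K (x i).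

(** Exchanging the products over generators and coordinates shows the rows to be independent and
    uniform on K^t. *)
Lemma iid_uniform_gpowE (h : {ffun 'I_t -> gpow_type gT n}) :
  iid_law (uniform_law R (gpow n K)) h = \prod_k unif_row (generator_row h k).
Proof.
rewrite /iid_law /unif_row exchange_big; apply: eq_bigr => i _ /=.
rewrite /uniform_law big_split /= prodfV; congr (_ / _).
  have [Ghi|/setXnP nGhi] := boolP (h i \in gpow n K).
    by rewrite big1 // => k _; rewrite ffunE (setXnP Ghi).
  have [k nKk] : exists k, h i k \notin K.
    by apply/existsP; rewrite -negb_forall; apply/forallP.
  by rewrite (bigD1 k) //= ffunE (negPf nKk) mul0r.
by rewrite cardsXn natr_prod.
Qed.

(** Transposing the t by n array of entries makes the rows independent variables of summation. *)
Lemma sum_rows (phi : {ffun 'I_t -> gT} -> R) :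
  \sum_(h : {ffun 'I_t -> gpow_type gT n}) \prod_k phi (generator_row h k) =
  (\sum_x phi x) ^+ n.
Proof.
have -> : (\sum_x phi x) ^+ n = \prod_(k < n) \sum_x phi x.
  by rewrite prodr_const card_ord.
rewrite bigA_distr_bigA.
pose tr (r : {ffun 'I_n -> {ffun 'I_t -> gT}}) : {ffun 'I_t -> gpow_type gT n} :=
  [ffun i => [ffun k => r k i] : gpow_type gT n].
rewrite (reindex tr); last first.
  exists (fun h => [ffun k => generator_row h k]) => [r _|h _].
    by apply/ffunP => k; rewrite !ffunE; apply/ffunP => i; rewrite !ffunE.
  by apply/ffunP => i; rewrite ffunE; apply/ffunP => k; rewrite !ffunE.
apply: eq_bigr => r _; apply: eq_bigr => k _; congr phi.
by apply/ffunP => i; rewrite !ffunE.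
Qed.

Lemma sum_unif_row : \sum_x unif_row x = 1.
Proof.
rewrite -(bigA_distr_bigA (fun=> uniform_law R K)) big1 // => i _.
rewrite /uniform_law -mulr_suml.
have -> : \sum_(x : gT) (x \in K)%:R = #|K|%:R :> R.
  by rewrite -sum1_card natr_sum [RHS]big_mkcond; apply: eq_bigr => x _; case: ifP.
by rewrite mulfV // pnatr_eq0 -lt0n cardG_gt0.
Qed.

(** The point [x0] has mass [|K|^-t] and loses half of it; no other point gains. *)
Lemma sum_unif_row_half (f : {ffun {ffun 'I_t -> gT} -> gT}) (x0 : {ffun 'I_t -> gT}) :
    x0 \in ffun_on K -> f x0 != 1%g ->
  0 <= \sum_x unif_row x * 2^-1 ^+ (f x != 1%g) <= 1 - (2 * #|K|%:R ^+ t)^-1.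
Proof.
move=> /ffun_onP Kx0 fx0.
have unif_ge0 x : 0 <= unif_row x.
  by apply: prodr_ge0 => i _; rewrite /uniform_law divr_ge0.
apply/andP; split; first by apply: sumr_ge0 => x _; rewrite mulr_ge0 ?exprn_ge0.
have unif_x0 : unif_row x0 = (#|K|%:R ^+ t)^-1.
  rewrite /unif_row (eq_bigr (fun=> #|K|%:R^-1)) => [|i _].
    by rewrite prodr_const card_ord exprVn.
  by rewrite /uniform_law Kx0 mul1r.
rewrite -[X in _ <= X - _]sum_unif_row [X in _ <= X - _](bigD1 x0) //=.
rewrite (bigD1 x0) //= fx0 expr1.
rewrite addrAC lerD //; last first.
  apply: ler_sum => x _; rewrite ler_piMr // exprn_ile1 //; lra.
rewrite unif_x0 invfM; lra.
Qed.

End RandomSubgroup.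

(** * Numerical estimates *)

(** From [ln 2 <= 1]. *)
Lemma expN_le_power2 (R : realType) (x : R) : 0 <= x -> expR (- x) <= 2 `^ (- x).
Proof.
move=> x_ge0; rewrite /powR pnatr_eq0 /= ler_expR mulNr lerN2 ler_piMr //.
have := @le_ln1Dx R 1; rewrite -natr1 addrC; apply; lra.
Qed.

(** Put [M = 2 c^t] and [s = sqrt n]. The first factor equals [c^M] with [M <= alpha s], and the
    second is at most [exp(-n/M) <= exp(-s/alpha)], as [n = s^2]. *)
Lemma word_count_bound (R : realType) (c n t : nat) (alpha : R) :
    (0 < c)%N -> (0 < n)%N -> 2 * c%:R ^+ t <= alpha * Num.sqrt n%:R ->
  (c ^ (c ^ t))%:R ^+ 2 * (1 - (2 * c%:R ^+ t)^-1) ^+ n <=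
  ((2 : R) `^ (- (1 / alpha)) * c%:R `^ alpha) `^ Num.sqrt n%:R.
Proof.
move=> c_gt0 n_gt0; set s := Num.sqrt n%:R; set M := 2 * c%:R ^+ t => le_M.
have s_gt0 : 0 < s by rewrite sqrtr_gt0 ltr0n.
have ct_ge1 : 1 <= c%:R ^+ t :> R by rewrite exprn_ege1 // ler1n.
have M_gt0 : 0 < M by rewrite /M; lra.
have alpha_gt0 : 0 < alpha by rewrite -(pmulr_lgt0 _ s_gt0) (lt_le_trans M_gt0).
rewrite powRM ?powR_ge0 // -!powRrM mulrC ler_pM //.
- by rewrite exprn_ge0 // subr_ge0 invf_le1 // /M; lra.
- apply: (@le_trans _ _ (expR (- (s / alpha)))); last first.
    rewrite -[leRHS]/(_ `^ _) mulNr div1r mulrC expN_le_power2 //.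
    by rewrite mulr_ge0 ?invr_ge0 ?ltW.
  apply: (@le_trans _ _ (expR (- M^-1) ^+ n)).
    apply: lerXn2r; rewrite ?nnegrE ?expR_ge0 //.
      by rewrite subr_ge0 invf_le1 // /M; lra.
    exact: expR_ge1Dx.
  rewrite -expRM_natl ler_expR mulrN lerN2.
  have -> : n%:R = s ^+ 2 by rewrite sqr_sqrtr ?ler0n.
  rewrite ler_pdivlMr // mulrAC ler_pdivrMr //.
  by rewrite expr2 -mulrA ler_pM2l // [s * _]mulrC.
rewrite natrX -exprM -powR_mulrn ?ler0n // ler_powR ?ler1n //.
by rewrite natrM natrX mulrC.
Qed.

(** * Expected Plancherel mass of the event [X_H = 0] *)

Section FailureProbability.
Variables (R : realType) (gT : finGroupType) (K : {group gT}) (n t : nat).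

Lemma half_support_ge0 (g : gpow_type gT n) : 0 <= half_support R g.
Proof. by apply: prodr_ge0 => k _; rewrite exprn_ge0 // invr_ge0. Qed.

Lemma twisted_fix_half_support (g h : gpow_type gT n) :
    'Z(K)%g = 1%g -> g \in gpow n K ->
  #|twisted_fix (gpow n K) g h|%:R / #|gpow n K|%:R <= half_support R g.
Proof.
move=> Z1 /setXnP Kg; rewrite twisted_fix_gpow cardsXn !natr_prod -prodf_div.
apply: ler_prod => k _; rewrite divr_ge0 //=.
have K0 : 0 < #|K|%:R :> R by rewrite ltr0n cardG_gt0.
rewrite ler_pdivrMr // exprVn ler_pdivlMl ?exprn_gt0 // -natrX -natrM ler_nat.
exact: twisted_fix_half.
Qed.

Lemma expected_half_support (f : {ffun {ffun 'I_t -> gT} -> gT}) :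
    f \in word_maps K t -> f != [ffun=> 1%g] ->
  \sum_(h : {ffun 'I_t -> gpow_type gT n})
     iid_law (uniform_law R (gpow n K)) h * half_support R (eval_rows h f) <=
  (1 - (2 * #|K|%:R ^+ t)^-1) ^+ n.
Proof.
move=> /word_mapsP Wf f_neq1.
have [x0 fx0] : exists x0, f x0 != 1%g.
  apply/existsP; rewrite -negb_forall; apply: contra f_neq1 => /forallP f1.
  by apply/eqP/ffunP => x; rewrite ffunE; apply/eqP.
(* A map in [word_maps] is 1 outside of K^t, so a point where it differs from 1 lies in K^t. *)
have Kx0 : x0 \in ffun_on K.
  by have := Wf x0; case: ifP => // _ /eqP fx01; rewrite fx01 eqxx in fx0.
have /andP[ge0 le1] := sum_unif_row_half R Kx0 fx0.
under eq_bigr => h _.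
  rewrite iid_uniform_gpowE /half_support -big_split /=.
  under eq_bigr => k _ do rewrite ffunE.
  over.
rewrite (sum_rows n (fun x => (unif_row R K x) * 2^-1 ^+ (f x != 1%g))).
by apply: lerXn2r; rewrite ?nnegrE // (le_trans ge0).
Qed.

Variables (I : finType) (d : I -> nat).
Variable rho : forall i, mx_representation R[i] (gpow n K) (d i).

Hypothesis Z1 : 'Z(K)%g = 1%g.
Hypothesis orth : {in gpow n K &, forall g h,
  \sum_i \tr (rho i g) * \tr (rho i h) = #|twisted_fix (gpow n K) g h|%:R}.

Let nontrivial_word := [pred f : {ffun {ffun 'I_t -> gT} -> gT} |
  (f \in word_maps K t) && (f != [ffun=> 1%g])].

Let gen (h : {ffun 'I_t -> gpow_type gT n}) := <<[set h i | i : 'I_t]>>%G.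

(** Every nontrivial element of the subgroup is the value of some nontrivial map. Summing over maps
    makes the index set independent of [h], so that expectations can be taken termwise. *)
Lemma sum_half_support_gen (h : {ffun 'I_t -> gpow_type gT n}) :
    (forall i, h i \in gpow n K) ->
  \sum_(g in gen h :\ 1%g) half_support R g <=
  \sum_(f | nontrivial_word f) half_support R (eval_rows h f).
Proof.
move=> Gh; rewrite [leRHS](partition_big (eval_rows h) predT) //=.
rewrite [leRHS](bigID (mem (gen h :\ 1%g))) /= -[leLHS]addr0 lerD //; last first.
  by do 2![apply: sumr_ge0 => ? _]; exact: half_support_ge0.
apply: ler_sum => g /setD1P[g_neq1 Hg].
have /imsetP[f Wf defg] := fintype.subsetP (gen_sub_eval_rows Gh) g Hg.
rewrite (bigD1 f) /=; last first.
  rewrite Wf defg eqxx andbT /=; apply: contraNneq g_neq1 => f1; rewrite defg f1.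
  by apply/eqP/ffunP => k; rewrite !ffunE.
by rewrite -defg lerDl sumr_ge0 // => ? _; exact: half_support_ge0.
Qed.

(** In the second moment bound, each inner sum over the subgroup has at most [#|word_maps K t|]
    terms, each at most [half_support R g] after division by the order of K^n. *)
Lemma plancherel_inv_ratio_eq0 (h : {ffun 'I_t -> gpow_type gT n}) :
    (forall i, h i \in gpow n K) ->
  \sum_(i | inv_ratio (rho i) (gen h) == 0) (d i)%:R ^+ 2 / #|gpow n K|%:R <=
  #|word_maps K t|%:R *
  \sum_(f | nontrivial_word f) half_support R (eval_rows h f) :> R.
Proof.
move=> Gh; have sHG : gen h \subset gpow n K.
  by rewrite gen_subG; apply/fintype.subsetP => _ /imsetP[i _ ->].
have le_H : (#|gen h| <= #|word_maps K t|)%N.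
  apply: leq_trans (subset_leq_card (gen_sub_eval_rows Gh)) _.
  exact: leq_imset_card.
apply: (@le_trans _ _ (#|gen h|%:R *
    \sum_(g in gen h :\ 1%g) half_support R g)); last first.
  rewrite ler_pM ?ler_nat ?sum_half_support_gen //.
  by apply: sumr_ge0 => ? _; exact: half_support_ge0.
rewrite -mulr_suml.
under eq_bigr => i _ do rewrite -natrX.
rewrite -natr_sum; have := sum_sqr_degree_inv_ratio_eq0 sHG orth.
rewrite -(ler_nat R) => /(ler_wpM2r (_ : 0 <= #|gpow n K|%:R^-1)) le1.
apply: le_trans (le1 _) _; first by rewrite invr_ge0.
rewrite natr_sum mulr_suml mulr_sumr; apply: ler_sum => g /setD1P[_ Hg].
rewrite natr_sum mulr_suml mulr_natl -[leRHS]sumr_const; apply: ler_sum => x _.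
by apply: twisted_fix_half_support => //; exact: (fintype.subsetP sHG).
Qed.

(** One factor [#|word_maps K t|] bounds the order of the subgroup, the other the number of
    nontrivial maps, whose expectations obey a common bound. *)
Lemma expected_inv_ratio_eq0 :
  \sum_(h : {ffun 'I_t -> gpow_type gT n}) iid_law (uniform_law R (gpow n K)) h *
    \sum_(i | inv_ratio (rho i) (gen h) == 0) (d i)%:R ^+ 2 / #|gpow n K|%:R <=
  #|word_maps K t|%:R ^+ 2 * (1 - (2 * #|K|%:R ^+ t)^-1) ^+ n.
Proof.
apply: (@le_trans _ _ (\sum_(h : {ffun 'I_t -> gpow_type gT n})
    iid_law (uniform_law R (gpow n K)) h * (#|word_maps K t|%:R *
      \sum_(f | nontrivial_word f) half_support R (eval_rows h f)))).
  apply: ler_sum => h _; have [Gh|] := boolP [forall i, h i \in gpow n K].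
    rewrite ler_wpM2l ?plancherel_inv_ratio_eq0 //; last exact/forallP.
    by apply: prodr_ge0 => i _; rewrite /uniform_law divr_ge0.
  (* A family with a member outside of K^n has probability 0. *)
  rewrite negb_forall => /existsP[i nGhi].
  by rewrite /iid_law (bigD1 i) //= /uniform_law (negPf nGhi) !mul0r.
under eq_bigr => h _ do rewrite mulrCA mulr_sumr.
rewrite -mulr_sumr exchange_big /= expr2 -mulrA ler_wpM2l //.
apply: (@le_trans _ _ (\sum_(f | nontrivial_word f) (1 - (2 * #|K|%:R ^+ t)^-1) ^+ n)).
  by apply: ler_sum => f /andP[Wf f_neq1]; exact: expected_half_support.
rewrite sumr_const -[leLHS]mulr_natl ler_wpM2r ?ler_nat //.
  rewrite exprn_ge0 // subr_ge0 invf_le1.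
    rewrite (le_trans _ (ler_peMr _ _)) ?exprn_ege1 ?ler1n ?cardG_gt0 //.
  by rewrite mulr_gt0 // exprn_gt0 // ltr0n cardG_gt0.
by apply: subset_leq_card; apply/fintype.subsetP => f /andP[].
Qed.

End FailureProbability.

(** * Operator norm and fixed vectors *)

Section OperatorNorm.
Variables (R : realType) (d : nat).
Implicit Types (A : 'M[R[i]]_d) (v : 'cV[R[i]]_d).

Local Notation normc := ComplexField.Normc.normc.

Lemma real_normc (z : R[i]) : (normc z)%:C%C = `|z|.
Proof. by []. Qed.

Lemma normc_ge0 (z : R[i]) : 0 <= normc z.
Proof. by rewrite -lecR real_normc rmorph0 normr_ge0. Qed.

Lemma l2norm_ge_entry v k : normc (v k 0) <= l2norm v.
Proof.
rewrite -[leLHS](ger0_norm (normc_ge0 _)) -sqrtr_sqr ler_wsqrtr //.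
by rewrite (bigD1 k) //= lerDl sumr_ge0 // => j _; rewrite exprn_ge0 // normc_ge0.
Qed.

Lemma l2normZ (c : R) v : 0 <= c -> l2norm (c%:C%C *: v) = c * l2norm v.
Proof.
move=> c_ge0; rewrite /l2norm -[in RHS](ger0_norm c_ge0) -sqrtr_sqr.
rewrite -sqrtrM ?sqr_ge0 // mulr_sumr; congr Num.sqrt.
apply: eq_bigr => k _; rewrite mxE ComplexField.Normc.normcM exprMn.
congr (_ ^+ 2 * _); apply: complexI.
by rewrite real_normc ger0_norm // -[0]/(0%:C)%C lecR.
Qed.

Lemma l2norm_gt0 v : v != 0 -> 0 < l2norm v.
Proof.
apply: contraNT; rewrite -leNgt => v_le0; apply/eqP/colP => k.
rewrite mxE; apply: ComplexField.Normc.eq0_normc; apply/eqP.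
by rewrite eq_le normc_ge0 (le_trans (l2norm_ge_entry v k)).
Qed.

(** Boundedness makes the [sup] in [opnorm] an actual supremum. The entries of [v] have modulus at
    most [l2norm v <= 1], so the row sums of moduli bound the entries of [A *m v]. *)
Lemma has_ubound_l2norm A :
  has_ubound [set l2norm (A *m v) | v in [set v | l2norm v <= 1]]%classic.
Proof.
exists (Num.sqrt (\sum_j (\sum_k normc (A j k)) ^+ 2)) => _ [v /= v_le1 <-].
rewrite ler_wsqrtr //; apply: ler_sum => j _.
rewrite lerXn2r ?nnegrE ?normc_ge0 ?sumr_ge0 // => [k _|]; first exact: normc_ge0.
rewrite -lecR real_normc mxE rmorph_sum (le_trans (ler_norm_sum _ _ _)) //.
apply: ler_sum => k _; rewrite normrM -!real_normc -rmorphM lecR.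
by rewrite ler_piMr ?normc_ge0 // (le_trans (l2norm_ge_entry v k)).
Qed.

Lemma opnorm_ge1_of_fixed A v : v != 0 -> A *m v = v -> 1 <= opnorm A.
Proof.
move=> /l2norm_gt0 v_gt0 Av.
have norm1 : l2norm ((l2norm v)^-1%:C%C *: v) = 1.
  by rewrite l2normZ ?invr_ge0 ?ltW // mulVf // gt_eqF.
apply: (ub_le_sup (has_ubound_l2norm A)); exists ((l2norm v)^-1%:C%C *: v) => /=.
  by rewrite norm1.
by rewrite -scalemxAr Av norm1.
Qed.

End OperatorNorm.

(** * Choice of a representation by averaging, and conclusion *)

(** If all [p i > b], the terms [w i * (p i - b)] are nonnegative with a nonpositive sum, which
    forces every weight to vanish, against their total 1. *)
Lemma mean_le_exists (R : realType) (I : finType) (w p : I -> R) (b : R) :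
    (forall i, 0 <= w i) -> \sum_i w i = 1 -> \sum_i w i * p i <= b ->
  exists i, p i <= b.
Proof.
move=> w_ge0 w_sum le_b; apply/existsP; apply: contraT.
rewrite negb_exists => /forallP gt_b.
have ge0 i : 0 <= w i * (p i - b).
  by rewrite mulr_ge0 // subr_ge0 ltW // ltNge.
have eq0 : \sum_i w i * (p i - b) = 0.
  apply/eqP; rewrite eq_le sumr_ge0 // andbT.
  under eq_bigr => i _ do rewrite mulrBr.
  by rewrite sumrB -mulr_suml w_sum mul1r subr_le0.
move/eqP: w_sum; rewrite big1 ?(eq_sym 0) ?oner_eq0 // => i _.
have /eqP : w i * (p i - b) = 0 by exact: (psumr_eq0P (fun i _ => ge0 i) eq0).
by rewrite mulf_eq0 subr_eq0 [p i == b]gt_eqF ?ltNge // orbF => /eqP.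
Qed.

(** If the ratio is nonzero, so is the mean over the generated subgroup; a nonzero column of it is
    fixed by each [h i], hence by their mean. *)
Lemma opnorm_mean_lt1 (R : realType) (gT : finGroupType) (G : {group gT})
    (d t : nat) (rG : mx_representation R[i] G d) (h : 'I_t -> gT) :
    (0 < t)%N -> (forall i, h i \in G) ->
    opnorm (t%:R^-1 *: \sum_(i < t) rG (h i)) < 1 ->
  inv_ratio rG <<[set h i | i : 'I_t]>>%G = 0.
Proof.
move=> t_gt0 Gh; set H := <<_>>%G; apply: contraTeq => ratio_neq0.
have sHG : H \subset G.
  by rewrite gen_subG; apply/fintype.subsetP => _ /imsetP[i _ ->].
have [j /eqP/eqP v_neq0] : exists j,
    col j (#|H|%:R^-1 *: \sum_(x in H) rG x) != 0.
  apply/existsP; apply: contraNT ratio_neq0; rewrite negb_exists => /forallP col0.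
  rewrite inv_ratioE //.
  set P := _ *: _ in col0 *; suff -> : P = 0 by rewrite mxrank0 mul0r.
  apply/matrixP => i k; have /negPn/eqP/colP/(_ i) := col0 k.
  by rewrite !mxE.
rewrite -leNgt; apply: (opnorm_ge1_of_fixed v_neq0).
rewrite colE mulmxA; congr (_ *m _); rewrite -scalemxAl mulmx_suml.
under eq_bigr => i _.
  rewrite group_mean_fixed //; last by rewrite mem_gen // imset_f.
  over.
rewrite sumr_const card_ord -scalerMnr scalerMnl -[_^-1 *+ t]mulr_natl.
by rewrite mulfV ?scale1r // pnatr_eq0 -lt0n.
Qed.

Theorem theorem1 (R : realType) (gT : finGroupType) (K : {group gT})
    (n t : nat) (alpha : R) :
  'Z(K)%g = 1%g -> (0 < n)%N -> (0 < t)%N ->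
  2 * #|K|%:R ^+ t <= alpha * Num.sqrt n%:R ->
  let G := gpow n K in
  let hlaw := iid_law (uniform_law R G) (t := t) in
  let bound := 2 * alpha / Num.sqrt n%:R +
    ((2 : R) `^ (- (1 / alpha)) * #|K|%:R `^ alpha) `^ Num.sqrt n%:R in
  Pr (prod_law (@plancherel R _ G) hlaw)
    [pred x : dual R G * {ffun 'I_t -> gpow_type gT n} |
      inv_ratio (irr_repr x.1) <<[set x.2 i | i : 'I_t]>>%G == 0]
    <= bound
  /\
  exists (d : 'I_n -> nat) (rho : forall k, mx_representation R[i] K (d k)),
    [/\ forall k, mx_irreducible (rho k),
        forall k, unitary_repr (rho k),
        mx_irreducible (tens_repr rho) &
        Pr hlaw
          [pred h : {ffun 'I_t -> gpow_type gT n} |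
            opnorm (t%:R^-1 *: \sum_(i < t) tens_repr rho (h i)) < 1]
          <= bound].
Proof.
move=> Z1 n_gt0 t_gt0 le_alpha G hlaw bound.
have K_gt0 : (0 < #|K|)%N := cardG_gt0 K.
have s_gt0 : 0 < Num.sqrt n%:R :> R by rewrite sqrtr_gt0 ltr0n.
have alpha_ge0 : 0 <= alpha.
  rewrite -(pmulr_lge0 _ s_gt0); apply: le_trans le_alpha.
  by rewrite mulr_ge0 // exprn_ge0.
have le_bound : #|word_maps K t|%:R ^+ 2 * (1 - (2 * #|K|%:R ^+ t)^-1) ^+ n <= bound.
  apply: le_trans (_ : _ <= _) _.
    by rewrite card_word_maps; exact: word_count_bound le_alpha.
  by rewrite /bound lerDr divr_ge0 ?mulr_ge0 // ltW.
split.
  apply: le_trans le_bound; apply: le_trans (expected_inv_ratio_eq0 t Z1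
    (fun g h Gg Gh => irr_second_orthogonality (dual R G) Gg Gh)).
  under [leRHS]eq_bigr => h _ do rewrite mulr_sumr.
  rewrite (exchange_big_dep predT) //= /Pr /prod_law -(pair_big_dep predT
    (fun (i : dual R G) (h : {ffun 'I_t -> gpow_type gT n}) =>
      inv_ratio (irr_repr i) <<[set h i | i : 'I_t]>>%G == 0)
    (fun i h => plancherel i * hlaw h)) /=.
  by apply: ler_sum => i _; apply: ler_sum => h _; rewrite mulrC.
(* Second claim: each class of K gets a unitary representative, with the same character. *)
have /(_ _)/cid2 uni (i : dual R K) := unitary_rsim (irr_repr i).
pose rho i := projT1 (uni i).
have rsim_rho i : mx_rsim (irr_repr i) (rho i) by rewrite /rho; case: (uni i).
have irr_rho i : mx_irreducible (rho i).
  exact: mx_rsim_irr (rsim_rho i) (socle_irr i).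
have orth : {in K &, forall g h,
    \sum_i \tr (rho i g) * \tr (rho i h) = #|twisted_fix K g h|%:R}.
  move=> g h Kg Kh; rewrite -(irr_second_orthogonality (dual R K) Kg Kh).
  by apply: eq_bigr => i _; rewrite -!(mxtrace_rsim (rsim_rho i)).
have orthG := second_orthogonality_tens (n := n) orth.
(* As degrees multiply, [w] is the product of the Plancherel measures of the coordinates. *)
pose w (r : {ffun 'I_n -> dual R K}) : R :=
  #|tens_index (fun k => irr_degree (r k))|%:R ^+ 2 / #|G|%:R.
pose p (r : {ffun 'I_n -> dual R K}) : R :=
  \sum_(h : {ffun 'I_t -> gpow_type gT n} | inv_ratio (tens_repr (fun k => rho (r k)))
    <<[set h i | i : 'I_t]>>%G == 0) hlaw h.
have [r le_p] : exists r, p r <= bound.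
  apply: (@mean_le_exists _ _ w).
  - by move=> r; rewrite /w divr_ge0 // exprn_ge0.
  - rewrite /w -mulr_suml; under eq_bigr => r _ do rewrite -natrX.
    by rewrite -natr_sum (sum_sqr_degree orthG) mulfV // pnatr_eq0 -lt0n cardG_gt0.
  - apply: le_trans le_bound; apply: le_trans (expected_inv_ratio_eq0 t Z1 orthG).
    under [leRHS]eq_bigr => h _ do rewrite mulr_sumr.
    rewrite (exchange_big_dep predT) //=; apply: ler_sum => r _.
    rewrite /p mulr_sumr.
    by apply: ler_sum => h _; rewrite mulrC.
exists (fun k => irr_degree (r k)), (fun k => rho (r k)); split.
- by move=> k; exact: irr_rho.
- by move=> k; rewrite /rho; case: (uni _).
- apply/mx_abs_irrW/tens_abs_irr => k.
  exact/group_closure_closed_field/irr_rho.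
(* Where all [h i] lie in [G], the norm event implies that the ratio is 0; elsewhere [hlaw]
   vanishes. *)
- apply: le_trans le_p; rewrite /Pr /p big_mkcond [leRHS]big_mkcond.
  apply: ler_sum => h _ /=; have hlaw_ge0 : 0 <= hlaw h.
    by apply: prodr_ge0 => i _; rewrite /uniform_law divr_ge0.
  case: ifPn => [lt1|_]; last by case: ifP.
  have [Gh|] := boolP [forall i, h i \in G].
    have ratio0 := @opnorm_mean_lt1 R _ G _ t (tens_repr (fun k => rho (r k))) h t_gt0.
    by rewrite ifT //; apply/eqP/ratio0 => //; exact/forallP.
  rewrite negb_forall => /existsP[i nGhi].
  have -> : hlaw h = 0.
    by rewrite /hlaw /iid_law (bigD1 i) //= /uniform_law (negPf nGhi) !mul0r.
  by case: ifP.
Qed.
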